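(* Let $p>3$ be a prime. Then $$\sum_{k=0}^{(p-1)/2}\frac{\binom{2k}k\binom{4k}{2k}}{64^k}\equiv(-1)^{[\frac p4]}\big(1+P_{p-(\frac 2p)}\big)\pmod{p^2}.$$
   Context: $[x]$ is the greatest integer not exceeding $x$; $\big(\frac 2p\big)$ is the Legendre symbol. $\{P_n\}$ is the Pell sequence: $P_0=0$, $P_1=1$, $P_{n+1}=2P_n+P_{n-1}$ for $n\ge1$. Congruences are in the ring of rationals with denominators prime to $p$. *)

(* Defs.v *)
From mathcomp Require Import all_boot all_order all_algebra.
Set Implicit Arguments.
Unset Strict Implicit.
Unset Printing Implicit Defensive.
Import Order.TTheory GRing.Theory Num.Theory.
Local Open Scope ring_scope.

(* The ring of rationals whose reduced denominator is prime to p. *)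
Definition p_integral (p : nat) : {pred rat} :=
  [pred x | coprime p `|denq x|%N].

(* x = y (mod m) in the ring of p-integral rationals: both sides lie in that
   ring and differ by an element of the principal ideal generated by m. *)
Definition p_integral_congr (p m : nat) (x y : rat) : Prop :=
  [/\ x \in p_integral p, y \in p_integral p
    & exists2 z : rat, z \in p_integral p & x - y = m%:R * z].

(* Meaningful for p an odd prime. *)
Definition legendre (a : int) (p : nat) : int :=
  if (p %| a)%Z then 0
  else if [exists x : 'I_p, (x%:Z ^+ 2 == a %[mod p])%Z] then 1
  else -1.

Fixpoint pell (n : nat) : nat :=
  match n with
  | 0%N => 0%N
  | n1.+1 => match n1 with
             | 0%N => 1%N
             | n2.+1 => (2 * pell n1 + pell n2)%N
             end
  end.

(* Main.v *)
Require Import Defs.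
From HB Require Import structures.
From mathcomp Require Import all_boot all_order all_algebra all_field.
From mathcomp Require Import ring lra zify.
Set Implicit Arguments.
Unset Strict Implicit.
Unset Printing Implicit Defensive.
Import Order.TTheory GRing.Theory Num.Theory.
Local Open Scope ring_scope.

(* Let p = 2n+1, m = [p/4], y = -p/4, and let S(x) be the sum over k <= n of
   'C(x, k) 'C(-1-x, k). The sum in the theorem is S(-1/4) = S(-3/4), and
   y + m is one of -1/4, -3/4. Telescoping gives
     S(x) + S(x-1) = 2 R(x),   R(x) = prod_(1 <= i <= n) (1 - x^2/i^2),
   so that S(y+m) is expressed through S(y) and R(y+1), ..., R(y+m); modulo p^2
   one has S(y) = 1 - y H_n and R(y+j) = y/j, hence
     (-1)^m S(y+m) = 1 + p H_n/4 - (p/2) sum_(1 <= j <= m) (-1)^j/j.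
   The two harmonic sums come from the expansions modulo p^2 of
     2^(p-1) = sum_k 'C(p, 2k)   and   tau = sum_j (-1)^j 'C(p, 4j).
   Since 1 + zeta has square zeta (2 + sqrt 2) = zeta sqrt 2 (1 + sqrt 2) for a
   primitive eighth root of unity zeta, 4 tau^2 is 2^n times an affine form in the
   coefficients of (1 + sqrt 2)^(p - (2/p)), which brings in the Pell number. *)

(** * Congruences between p-integral rationals *)

(** By Gauss's lemma the reduced denominator divides any nonzero denominator [b]. *)
Lemma p_integral_frac (p : nat) (a b : int) :
  coprime p `|b|%N -> a%:~R / b%:~R \in p_integral p.
Proof.
(* Division by zero gives 0, whose denominator is 1. *)
have [->|b0] := eqVneq b 0; first by rewrite invr0 mulr0 inE /= coprimen1.
move=> co_pb; rewrite inE /=; set x := a%:~R / b%:~R.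
have xb : numq x * b = a * denq x.
  apply: (@intr_inj rat); rewrite !rmorphM /= -[X in _ = _ * X]mulr1.
  have bQ : b%:~R != 0 :> rat by rewrite intr_eq0.
  have dQ : (denq x)%:~R != 0 :> rat by rewrite intr_eq0 denq_neq0.
  have := divq_num_den x; rewrite {3}/x => /(canRL (mulfVK dQ)) ->.
  by field.
apply: coprime_dvdr co_pb.
rewrite -(@Gauss_dvdr _ `|numq x|); last by rewrite coprime_sym coprime_num_den.
by rewrite -abszM xb abszM dvdn_mull.
Qed.

Lemma p_integral_subring p : subring_closed (p_integral p).
Proof.
have E (x : rat) : x = (numq x)%:~R / (denq x)%:~R by rewrite divq_num_den.
have nz (x : rat) : (denq x)%:~R != 0 :> rat by rewrite intr_eq0 denq_neq0.
split=> [|x y xI yI|x y xI yI]; first by rewrite inE /= coprimen1.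
- have -> : x - y = (numq x * denq y - numq y * denq x)%:~R
                     / (denq x * denq y)%:~R.
    by rewrite {1}[x]E {1}[y]E rmorphB !rmorphM /=; field; rewrite !nz.
  by apply: p_integral_frac; rewrite abszM coprimeMr; apply/andP.
- have -> : x * y = (numq x * numq y)%:~R / (denq x * denq y)%:~R.
    by rewrite {1}[x]E {1}[y]E !rmorphM /=; field; rewrite !nz.
  by apply: p_integral_frac; rewrite abszM coprimeMr; apply/andP.
Qed.

HB.instance Definition _ (p : nat) :=
  GRing.isSubringClosed.Build rat (p_integral p) (@p_integral_subring p).

Lemma p_integral_natV (p n : nat) : coprime p n -> n%:R^-1 \in p_integral p.
Proof. by move=> co_pn; have := @p_integral_frac p 1 n co_pn; rewrite mul1r. Qed.

(** The ideal generated by p^e, expressed by division: membership needs no witness and closure under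
    subtraction is immediate. *)
Definition p_ideal (p e : nat) : {pred rat} :=
  [pred x | x / p%:R ^+ e \in p_integral p].

Lemma p_idealE p e x : (x \in p_ideal p e) = (x / p%:R ^+ e \in p_integral p).
Proof. by []. Qed.

Lemma p_ideal_zmod p e : zmod_closed (p_ideal p e).
Proof.
split=> [|x y xI yI]; first by rewrite p_idealE mul0r rpred0.
by rewrite p_idealE mulrBl rpredB.
Qed.

HB.instance Definition _ (p e : nat) :=
  GRing.isZmodClosed.Build rat (p_ideal p e) (@p_ideal_zmod p e).

Lemma p_ideal0 p : p_ideal p 0 =i p_integral p.
Proof. by move=> x; rewrite p_idealE divr1. Qed.

Lemma p_idealM p a b x y :
  x \in p_ideal p a -> y \in p_ideal p b -> x * y \in p_ideal p (a + b).
Proof.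
move=> xI yI; rewrite p_idealE exprD invfM mulrACA.
exact: rpredM.
Qed.

Lemma p_idealMl p e x y :
  x \in p_integral p -> y \in p_ideal p e -> x * y \in p_ideal p e.
Proof. by rewrite -p_ideal0 => /p_idealM; apply. Qed.

Lemma p_idealMr p e x y :
  x \in p_ideal p e -> y \in p_integral p -> x * y \in p_ideal p e.
Proof. by rewrite mulrC => xI yI; apply: p_idealMl. Qed.

Lemma p_idealW p a b x : (0 < p)%N -> (b <= a)%N -> x \in p_ideal p a -> x \in p_ideal p b.
Proof.
move=> p0 /subnK <-; have pQ : p%:R != 0 :> rat by rewrite pnatr_eq0; lia.
rewrite !p_idealE exprD => xI.
have -> : x / p%:R ^+ b = x / (p%:R ^+ (a - b) * p%:R ^+ b) * p%:R ^+ (a - b).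
  by field; rewrite !expf_neq0.
by rewrite rpredM // rpredX // rpred_nat.
Qed.

Lemma p_ideal_congr p e x y :
    (0 < p)%N -> x \in p_integral p -> y \in p_integral p ->
  x - y \in p_ideal p e -> p_integral_congr p (p ^ e) x y.
Proof.
move=> p0 xI yI xyI; split=> //; exists ((x - y) / p%:R ^+ e) => //.
by rewrite natrX mulrC mulfVK // expf_neq0 // pnatr_eq0; lia.
Qed.

(** Links congruences modulo p between rationals with divisibility of integers, and so with
    computations in ['F_p]. *)
Lemma p_ideal_int p (z : int) : prime p -> (z%:~R \in p_ideal p 1) = (p %| `|z|)%N.
Proof.
move=> p_pr; have p0 := prime_gt0 p_pr.
have pQ : p%:R != 0 :> rat by rewrite pnatr_eq0; lia.
apply/idP/idP => [zI|/dvdnP[c zc]]; last first.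
  have -> : z = (Num.sg z * c%:Z) * p%:Z by rewrite {1}[z]intEsg zc PoszM mulrA.
  by rewrite p_idealE rmorphM /= expr1 mulfK // rpred_int.
have [//|co_p] := boolP (p %| _)%N.
(* If p does not divide [z], then [z] is a unit, so that 1/p would be p-integral. *)
have ziI : z%:~R^-1 \in p_integral p.
  have := @p_integral_frac p 1 z; rewrite mul1r; apply.
  by rewrite prime_coprime.
have z0 : z%:~R != 0 :> rat by rewrite intr_eq0; apply: contraNneq co_p => ->.
have := rpredM zI ziI; rewrite expr1 mulrAC divff // mul1r inE /=.
by rewrite -[p%:R]/(p%:~R) denqVz ?gtr0_norm // /coprime ?gcdnn => [/eqP|]; lia.
Qed.

Lemma p_ideal_nat p n : prime p -> (n%:R \in p_ideal p 1) = (p %| n)%N.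
Proof. by move=> p_pr; rewrite -[n%:R]/(n%:~R) p_ideal_int. Qed.

(** * The telescoping sum *)

(* 'C(x, k) * 'C(-1 - x, k) for a rational number x. *)
Definition bin_pair (x : rat) (k : nat) : rat :=
  \prod_(0 <= i < k) ((i%:R - x) * (i.+1%:R + x) / i.+1%:R ^+ 2).

Definition bin_pair_sum (x : rat) (n : nat) : rat :=
  \sum_(0 <= k < n.+1) bin_pair x k.

(** Euler's product for sin(pi x)/(pi x), cut after [n] factors. *)
Definition sine_prod (x : rat) (n : nat) : rat :=
  \prod_(0 <= i < n) (1 - (x / i.+1%:R) ^+ 2).

Lemma natrS_neq0 (n : nat) : n%:R + 1 != 0 :> rat.
Proof. by rewrite natr1 pnatr_eq0. Qed.

Lemma bin_pairC x k : bin_pair (- 1 - x) k = bin_pair x k.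
Proof.
rewrite /bin_pair; apply: eq_bigr => i _; rewrite -natr1.
by field; rewrite natrS_neq0.
Qed.

(** Regrouping: i + 1 - x from the factor of index i + 1 is paired with i + 1 + x from the factor of
    index i; one numerator is left over at each end. *)
Lemma bin_pairS x k :
  bin_pair x k.+1 = - x * (k.+1%:R + x) / k.+1%:R ^+ 2 * sine_prod x k.
Proof.
rewrite /bin_pair /sine_prod; elim: k => [|k IHk].
  by rewrite big_nat1 big_nil mulr1 sub0r.
rewrite big_nat_recr //= IHk [in RHS]big_nat_recr //= -!natr1.
by field; rewrite !natrS_neq0 natr1 natrS_neq0.
Qed.

Lemma bin_pairSB x k :
  bin_pair (x - 1) k.+1 = x * (k.+1%:R - x) / k.+1%:R ^+ 2 * sine_prod x k.
Proof.
rewrite -bin_pairC opprB addKr bin_pairS opprK.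
by rewrite /sine_prod; under eq_bigr do rewrite mulNr sqrrN.
Qed.

(** With R_k for [sine_prod x k], the two terms of index k + 1 add up to -2 x^2/(k+1)^2 R_k = 2
    (R_(k+1) - R_k), which telescopes. *)
Lemma bin_pair_sumD x n :
  bin_pair_sum x n + bin_pair_sum (x - 1) n = 2 * sine_prod x n.
Proof.
rewrite /bin_pair_sum -big_split /=; elim: n => [|n IHn].
  by rewrite big_nat1 /bin_pair /sine_prod !big_nil.
rewrite big_nat_recr //= IHn bin_pairS bin_pairSB /sine_prod [in RHS]big_nat_recr //=.
rewrite -!natr1; by field; rewrite natrS_neq0.
Qed.

Lemma bin_pair_sum_shift y n m :
  bin_pair_sum (y + m%:R) n =
  (-1) ^+ m * (bin_pair_sum y n
               + 2 * \sum_(0 <= j < m) (-1) ^+ j.+1 * sine_prod (y + j.+1%:R) n).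
Proof.
elim: m => [|m IHm]; first by rewrite big_nil mulr0 !addr0 mul1r.
have := bin_pair_sumD (y + m.+1%:R) n.
have -> : y + m.+1%:R - 1 = y + m%:R by rewrite -natr1 addrA addrK.
rewrite IHm => /(canRL (addrK _)) ->; rewrite big_nat_recr //= !exprS.
have := sqrr_sign rat m; set s := (-1) ^+ m; set r := sine_prod _ _ => s2.
set u := \sum_(_ <= _ < _) _; set v := bin_pair_sum _ _.
transitivity (2 * (s ^+ 2 * r) - s * (v + 2 * u)); first by rewrite s2 mul1r.
by ring.
Qed.

(** Up to a constant, [x * sine_prod x n] is the product of the 2n + 1 consecutive factors x - n,
    ..., x + n; the shift trades x - n for x + n + 1. *)
Lemma sine_prod_step x n :
  n%:R - x != 0 ->
  (x + 1) * sine_prod (x + 1) n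
    = - (n%:R + 1 + x) / (n%:R - x) * (x * sine_prod x n).
Proof.
(* The induction on [n] runs on the cross-multiplied form, which needs no condition at smaller
   [n]. *)
move=> nx; suff E : (n%:R - x) * ((x + 1) * sine_prod (x + 1) n)
                    = - (n%:R + 1 + x) * (x * sine_prod x n).
  by apply: (mulfI nx); rewrite E; field.
rewrite /sine_prod {nx}; elim: n => [|n IHn]; first by rewrite !big_nil; ring.
rewrite !big_nat_recr //= -!natr1; move: IHn.
set r := \prod_(_ <= _ < _) _; set r' := \prod_(_ <= _ < _) _ => IHn.
transitivity ((n%:R - x) * ((x + 1) * r) *
   ((n%:R + 1 - x) * (n%:R + 1 + 1 + x) / (n%:R + 1) ^+ 2)); last rewrite IHn.
  by field; rewrite natrS_neq0.
by field; rewrite natrS_neq0.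
Qed.

(** On both sides consecutive terms have the ratio (4k+1)(4k+3)/(16 (k+1)^2). *)
Lemma central_bin_term k :
  ('C(2 * k, k) * 'C(4 * k, 2 * k))%:R / 64%:R ^+ k = bin_pair (- (1 / 4)) k.
Proof.
have E k' : ('C(2 * k', k') * 'C(4 * k', 2 * k'))%:R
    = (4 * k')`!%:R / ((2 * k')`!%:R * k'`!%:R ^+ 2) :> rat.
  have nz j : j`!%:R != 0 :> rat by rewrite pnatr_eq0 -lt0n fact_gt0.
  have /(congr1 (fun n => n%:R : rat)) := @bin_fact (2 * k') k' ltac:(lia).
  have /(congr1 (fun n => n%:R : rat)) := @bin_fact (4 * k') (2 * k') ltac:(lia).
  have -> : (4 * k' - 2 * k' = 2 * k')%N by lia.
  have -> : (2 * k' - k' = k')%N by lia.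
  rewrite !natrM => <- <-; field; rewrite !nz /=.
  by rewrite pnatr_eq0 -lt0n bin_gt0; lia.
rewrite /bin_pair; elim: k => [|k IHk]; first by rewrite big_nil bin0 muln1.
rewrite big_nat_recr //= -IHk !E [64%:R ^+ k.+1]exprS.
have -> : (4 * k.+1 = (4 * k).+4)%N by lia.
have -> : (2 * k.+1 = (2 * k).+2)%N by lia.
have S j : j.+1%:R = j%:R + 1 :> rat by rewrite natr1.
rewrite !factS !natrM (S (4 * k).+3) (S (4 * k).+2) (S (4 * k).+1) (S (4 * k)%N).
rewrite (S (2 * k).+1) (S (2 * k)%N) (S k) !natrM.
have nz j : j`!%:R != 0 :> rat by rewrite pnatr_eq0 -lt0n fact_gt0.
have n64 : 64%:R ^+ k != 0 :> rat by rewrite expf_neq0.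
set F := _`!%:R; field; rewrite !nz n64 natrS_neq0 /=.
by rewrite -!natrM !natr1 !pnatr_eq0.
Qed.

Lemma p_integral_intV (p : nat) (z : int) :
  prime p -> ~~ (p %| `|z|)%N -> z%:~R^-1 \in p_integral p.
Proof.
move=> p_pr pz; have := @p_integral_frac p 1 z; rewrite mul1r; apply.
by rewrite prime_coprime.
Qed.

Lemma p_integral_ltV p i : (0 < i < p)%N -> prime p -> i%:R^-1 \in p_integral p.
Proof.
move=> ip p_pr; apply: p_integral_natV; rewrite prime_coprime //.
by apply/negP => /dvdn_leq; lia.
Qed.

Lemma quarter_p_ideal p : prime p -> (3 < p)%N -> - (p%:R / 4%:R) \in p_ideal p 1.
Proof.
move=> p_pr p3; rewrite rpredN; apply: p_idealMr.
  by rewrite p_ideal_nat.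
(* The bound needed is 4 < p, and 4 is not prime. *)
by apply: p_integral_ltV => //; have : p != 4%N; [apply: contraTneq p_pr => -> | lia].
Qed.

(** * Values modulo p^2 at the points -p/4 + j *)

Definition harmonic (n : nat) : rat := \sum_(0 <= i < n) i.+1%:R^-1.

Section QuarterShift.

Variables (p n : nat) (y : rat).
Hypotheses (p_pr : prime p) (p_gt3 : (3 < p)%N) (pE : p = (2 * n).+1).
Hypothesis yE : y = - (p%:R / 4%:R).

Let p0 : (0 < p)%N. Proof. exact: prime_gt0. Qed.

Let yI : y \in p_ideal p 1. Proof. by rewrite yE quarter_p_ideal. Qed.

Let integral_y : y \in p_integral p.
Proof. by rewrite -p_ideal0; apply: p_idealW yI. Qed.

(** Each factor is 1 modulo p^2: [y] is divisible by p, and the denominators, being below p, are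
    units. *)
Lemma sine_prod_small k : (k < p)%N -> sine_prod y k - 1 \in p_ideal p 2.
Proof.
rewrite /sine_prod; elim: k => [|k IHk] kp; first by rewrite big_nil subrr rpred0.
rewrite big_nat_recr //=; move: IHk; set r := \prod_(_ <= _ < _) _ => /(_ (ltnW kp)) IHk.
have fI : (y / k.+1%:R) ^+ 2 \in p_ideal p (1 + 1).
  by rewrite expr2; apply: p_idealM; apply: p_idealMr; rewrite ?p_integral_ltV.
have -> : r * (1 - (y / k.+1%:R) ^+ 2) - 1 =
   (r - 1) * (1 - (y / k.+1%:R) ^+ 2) - (y / k.+1%:R) ^+ 2 by ring.
rewrite rpredB //; apply: p_idealMr => //.
by rewrite rpredB ?rpred1 // -p_ideal0; apply: p_idealW fI.
Qed.

(** The form given by [bin_pairS] has a factor [y], so its cofactor matters only modulo p. *)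
Lemma bin_pair_small k :
  (k.+1 < p)%N -> bin_pair y k.+1 + y / k.+1%:R \in p_ideal p 2.
Proof.
move=> kp; have kI : k.+1%:R^-1 \in p_integral p by apply: p_integral_ltV.
have : k.+1%:R != 0 :> rat by rewrite pnatr_eq0.
rewrite bin_pairS; set r := sine_prod y k; move: (k.+1%:R) kI => t kI t0.
have -> : - y * (t + y) / t ^+ 2 * r + y / t =
   - (y * t^-1) * ((r - 1) * (1 + y * t^-1)) - (y * t^-1) * (y * t^-1).
  by field.
have ytI : y * t^-1 \in p_ideal p 1 by apply: p_idealMr.
have ytI0 : y * t^-1 \in p_integral p by rewrite rpredM.
rewrite rpredB ?(p_idealM ytI ytI) // p_idealMl ?rpredN // p_idealMr //.
  by apply: sine_prod_small; lia.
by rewrite rpredD ?rpred1.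
Qed.

Lemma bin_pair_sum_small k : (k < p)%N ->
  bin_pair_sum y k - (1 - y * harmonic k) \in p_ideal p 2.
Proof.
rewrite /bin_pair_sum /harmonic; elim: k => [|k IHk] kp.
  by rewrite big_nat1 /bin_pair !big_nil mulr0 subr0 subrr rpred0.
rewrite big_nat_recr //= [\sum_(0 <= i < k.+1) _^-1]big_nat_recr //=.
set u := \sum_(_ <= _ < _) _; set v := \sum_(_ <= _ < _) _.
rewrite (_ : _ - _ = u - (1 - y * v) + (bin_pair y k.+1 + y / k.+1%:R)).
  by rewrite rpredD ?bin_pair_small // IHk // ltnW.
by ring.
Qed.

(** As p = 2n + 1, the ratio in [sine_prod_step] is 1 - p/(n - x). The quantity starts as a multiple
    of p, so a ratio congruent to 1 modulo p leaves it unchanged modulo p^2. *)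
Lemma sine_prod_shift j : (4 * j < p)%N ->
  (y + j%:R) * sine_prod (y + j%:R) n - y \in p_ideal p 2.
Proof.
elim: j => [|j IHj] jp.
  rewrite addr0 -[X in _ - X]mulr1 -mulrBr p_idealMl ?sine_prod_small //.
  by lia.
have {IHj} := IHj ltac:(lia).
rewrite -natr1 addrA; set x := y + j%:R => IHj.
have nxE : n%:R - x = (6 * n%:Z + 1 - 4 * j%:Z)%:~R / 4%:R.
  by rewrite /x yE pE rmorphB rmorphD !rmorphM /= -natr1 natrM; field.
have nxI : (n%:R - x)^-1 \in p_integral p.
  rewrite nxE invf_div rpredM ?rpred_nat // p_integral_intV //.
  (* This number is 4 (n - x); modulo p it is -2 (2j + 1), where 2j + 1 < p. *)
  have -> : `|(6 * n%:Z + 1 - 4 * j%:Z)%R|%N = (3 * p - 2 * (2 * j + 1))%N by lia.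
  rewrite dvdn_subr; [|lia|exact: dvdn_mull].
  rewrite Euclid_dvdM // negb_or; apply/andP.
  by split; apply/negP => /dvdn_leq; lia.
have nx0 : n%:R - x != 0.
  rewrite nxE mulf_neq0 ?invr_eq0 // intr_eq0; lia.
rewrite sine_prod_step //; set a := x * _.
have -> : - (n%:R + 1 + x) / (n%:R - x) * a - y
   = (1 - p%:R * (n%:R - x)^-1) * (a - y) - p%:R * (n%:R - x)^-1 * y.
  by rewrite pE -natr1 natrM; field.
have pI : p%:R * (n%:R - x)^-1 \in p_ideal p 1.
  by apply: p_idealMr => //; rewrite p_ideal_nat.
rewrite rpredB ?(p_idealM pI yI) // p_idealMl // rpredB ?rpred1 //.
by rewrite rpredM ?rpred_nat.
Qed.

(** Divide by the unit y + j; since y^2 vanishes modulo p^2, y/(y + j) may be replaced by y/j. *)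
Lemma sine_prod_shiftV j : (0 < j)%N -> (4 * j < p)%N ->
  sine_prod (y + j%:R) n - y / j%:R \in p_ideal p 2.
Proof.
move=> j0 jp; have xE : y + j%:R = (4 * j%:Z - p%:Z)%:~R / 4%:R.
  by rewrite yE rmorphB rmorphM /=; field.
have xI : (y + j%:R)^-1 \in p_integral p.
  rewrite xE invf_div rpredM ?rpred_nat // p_integral_intV //.
  have -> : `|(4 * j%:Z - p%:Z)%R|%N = (p - 4 * j)%N by lia.
  by rewrite dvdn_subr ?(ltnW jp) //; apply/negP => /dvdn_leq; lia.
have x0 : y + j%:R != 0 by rewrite xE mulf_neq0 ?invr_eq0 // intr_eq0; lia.
have jI : j%:R^-1 \in p_integral p by apply: p_integral_ltV => //; lia.
have jQ : j%:R != 0 :> rat by rewrite pnatr_eq0; lia.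
set r := sine_prod _ _.
have -> : r - y / j%:R =
   (y + j%:R)^-1 * ((y + j%:R) * r - y) - j%:R^-1 * (y + j%:R)^-1 * (y * y).
  by field; rewrite x0 jQ.
rewrite rpredB //; first by rewrite p_idealMl // sine_prod_shift.
by rewrite p_idealMl ?rpredM // (p_idealM yI yI).
Qed.

Lemma bin_pair_sum_quarter m : (4 * m < p)%N ->
  bin_pair_sum (y + m%:R) n
   - (-1) ^+ m * (1 - y * harmonic n
                    + 2 * y * \sum_(0 <= j < m) (-1) ^+ j.+1 / j.+1%:R)
  \in p_ideal p 2.
Proof.
move=> mp; rewrite bin_pair_sum_shift -mulrBr p_idealMl ?rpredX ?rpredN ?rpred1 //.
set h := harmonic n; set u := \sum_(_ <= _ < m) _; set v := \sum_(_ <= _ < m) _.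
have -> : bin_pair_sum y n + 2 * u - (1 - y * h + 2 * y * v)
   = bin_pair_sum y n - (1 - y * h) + 2%:R * (u - y * v) by ring.
rewrite rpredD //; first by apply: bin_pair_sum_small; lia.
rewrite p_idealMl ?rpred_nat // /u /v mulr_sumr -sumrB big_nat_cond.
apply: rpred_sum => j /andP[/andP[_ jm] _].
rewrite mulrCA -mulrBr p_idealMl ?rpredX ?rpredN ?rpred1 //.
by apply: sine_prod_shiftV; lia.
Qed.

End QuarterShift.

(** * Binomial transforms at a prime *)

(** The value at (1 + X)^n of the linear form sending X^k to [w k]; shifting [w] amounts to
    multiplying by X. *)
Definition bin_transform (w : nat -> rat) (n : nat) : rat :=
  \sum_(0 <= k < n.+1) w k * 'C(n, k)%:R.

Lemma bin_transform0 w : bin_transform w 0 = w 0%N.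
Proof. by rewrite /bin_transform big_nat1 mulr1. Qed.

Lemma bin_transformS w n :
  bin_transform w n.+1 = bin_transform w n + bin_transform (fun k => w k.+1) n.
Proof.
rewrite /bin_transform big_nat_recl //= bin0 mulr1.
under eq_bigr do rewrite binS natrD mulrDr.
rewrite big_split /= addrA; congr (_ + _).
rewrite [in RHS]big_nat_recl //= bin0 mulr1 big_nat_recr //=.
by rewrite bin_small // mulr0 addr0.
Qed.

Lemma bin_transformZ c v w : (forall k, v k = c * w k) ->
  forall n, bin_transform v n = c * bin_transform w n.
Proof.
move=> vw n; rewrite /bin_transform mulr_sumr.
by apply: eq_bigr => k _; rewrite vw mulrA.
Qed.

Lemma big_nat_dvdn (F : nat -> rat) d n :
    (0 < d)%N -> (forall k, ~~ (d %| k)%N -> F k = 0) ->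
  \sum_(0 <= k < n) F k.+1 = \sum_(0 <= i < n %/ d) F (d * i.+1)%N.
Proof.
move=> d0 F0; elim: n => [|n IHn]; first by rewrite div0n !big_nil.
rewrite big_nat_recr //= IHn divnS //.
have [dn|ndn] := boolP (d %| n.+1)%N; last by rewrite F0 // addr0.
rewrite [in RHS]big_nat_recr //=; congr (_ + F _).
by rewrite -[n.+1](divnK dn) divnS // dn mulnC.
Qed.

(** Pascal's rule: neighbouring entries of row p - 1 add up to an entry of row p, a multiple of
    p. *)
Lemma bin_pred_prime p k : prime p -> (k < p)%N ->
  'C(p.-1, k)%:R - (-1) ^+ k \in p_ideal p 1.
Proof.
move=> p_pr; elim: k => [|k IHk] kp; first by rewrite bin0 subrr rpred0.
have pS : p = p.-1.+1 by rewrite prednK ?prime_gt0.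
have /(congr1 (fun n => n%:R : rat)) := binS p.-1 k; rewrite -pS natrD.
move/esym/(canRL (addrK _)) => ->; rewrite exprS.
have -> : 'C(p, k.+1)%:R - 'C(p.-1, k)%:R - -1 * (-1) ^+ k
    = 'C(p, k.+1)%:R - ('C(p.-1, k)%:R - (-1) ^+ k) :> rat by ring.
by rewrite rpredB ?IHk ?(ltnW kp) // p_ideal_nat // prime_dvd_bin.
Qed.

(** The binomial 'C(p, k+1) is p/(k+1) times 'C(p-1, k), and the latter is needed only modulo p. *)
Lemma bin_prime p k : prime p -> (k.+1 < p)%N ->
  'C(p, k.+1)%:R + p%:R * (-1) ^+ k.+1 / k.+1%:R \in p_ideal p 2.
Proof.
move=> p_pr kp; have pS : p = p.-1.+1 by rewrite prednK ?prime_gt0.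
have kQ : k.+1%:R != 0 :> rat by rewrite pnatr_eq0.
have := mul_bin_diag p k => /(congr1 (fun n => n%:R : rat)).
rewrite !natrM => E.
have -> : 'C(p, k.+1)%:R = k.+1%:R^-1 * (p%:R * 'C(p.-1, k)%:R) :> rat.
  by rewrite E mulKf.
rewrite exprS; set s := (-1) ^+ k.
rewrite (_ : _ + _ = k.+1%:R^-1 * (p%:R * ('C(p.-1, k)%:R - s))); last by ring.
rewrite p_idealMl //; first exact: p_integral_ltV.
apply: (@p_idealM p 1 1); first by rewrite p_ideal_nat.
by apply: bin_pred_prime => //; apply: ltnW.
Qed.

Lemma bin_transform_split p w : prime p ->
  bin_transform w p
  = w 0%N + \sum_(0 <= k < p.-1) w k.+1 * 'C(p, k.+1)%:R + w p.
Proof.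
move=> p_pr; have pS : p = p.-1.+1 by rewrite prednK ?prime_gt0.
rewrite /bin_transform big_nat_recr //= binn mulr1; congr (_ + _).
by rewrite {1}pS big_nat_recl // bin0 mulr1.
Qed.

Lemma bin_transform_prime p w : prime p -> (forall k, w k \in p_integral p) ->
  bin_transform w p - (w 0%N + w p) \in p_ideal p 1.
Proof.
move=> p_pr wI; rewrite bin_transform_split //.
set s := \sum_(_ <= _ < _) _.
have -> : w 0%N + s + w p - (w 0%N + w p) = s by ring.
rewrite /s big_nat_cond; apply: rpred_sum => k /andP[/andP[_ kp] _].
by rewrite p_idealMl // p_ideal_nat // prime_dvd_bin //; lia.
Qed.

Lemma bin_transform_prime2 p w : prime p -> (forall k, w k \in p_integral p) ->
  bin_transform w p
   - (w 0%N + w p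
      - p%:R * \sum_(0 <= k < p.-1) (-1) ^+ k.+1 * w k.+1 / k.+1%:R)
  \in p_ideal p 2.
Proof.
move=> p_pr wI; rewrite bin_transform_split // mulr_sumr.
set s := \sum_(_ <= _ < _) _; set t := \sum_(_ <= _ < _) _.
have -> : w 0%N + s + w p - (w 0%N + w p - t) = s + t by ring.
rewrite /s /t -big_split /= big_nat_cond; apply: rpred_sum => k /andP[/andP[_ kp] _].
have -> : w k.+1 * 'C(p, k.+1)%:R + p%:R * ((-1) ^+ k.+1 * w k.+1 / k.+1%:R)
   = w k.+1 * ('C(p, k.+1)%:R + p%:R * (-1) ^+ k.+1 / k.+1%:R) by ring.
by rewrite p_idealMl // bin_prime //; lia.
Qed.

(** * Powers of 2 and the sum over multiples of 4, modulo p^2 *)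

Definition even_weight (k : nat) : rat := (~~ odd k)%:R.

Lemma even_transform n : bin_transform even_weight n.+1 = 2 ^+ n.
Proof.
(* The sum over odd indices is carried along, since Pascal's rule exchanges the parities. *)
pose w1 k := even_weight k.+1.
have E v : bin_transform (fun k => even_weight k.+2) v = bin_transform even_weight v.
  by rewrite -[RHS]mul1r; apply: bin_transformZ => k; rewrite /even_weight /= negbK mul1r.
suff: bin_transform even_weight n.+1 = 2 ^+ n /\ bin_transform w1 n.+1 = 2 ^+ n by case.
elim: n => [|n [IH IH1]].
  by rewrite !bin_transformS !bin_transform0.
rewrite [_ even_weight _]bin_transformS [_ w1 _]bin_transformS E IH IH1 exprS.
by split; ring.
Qed.

(** Only the terms 1/(2i) survive. This is Eisenstein's congruence for the Fermat quotient of 2. *)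
Lemma pow2_prime n p : prime p -> p = (2 * n).+1 -> 
  2 ^+ (2 * n) - (1 - p%:R / 2 * harmonic n) \in p_ideal p 2.
Proof.
move=> p_pr pE; rewrite -even_transform -pE.
have := @bin_transform_prime2 p even_weight p_pr (fun k => rpred_nat _ _).
rewrite (_ : even_weight 0 + even_weight p = 1); last first.
  by rewrite /even_weight pE /= mul2n odd_double addr0.
rewrite (@big_nat_dvdn (fun k => (-1) ^+ k * even_weight k / k%:R) 2) //; last first.
  by move=> k; rewrite dvdn2 /even_weight => /negPf->; rewrite mulr0 mul0r.
have -> : (p.-1 %/ 2 = n)%N by rewrite pE /= mulKn.
set s := \sum_(_ <= _ < _) _; suff -> : p%:R * s = p%:R / 2 * harmonic n by [].
rewrite -mulrA; congr (_ * _); rewrite /s /harmonic mulr_sumr; apply: eq_bigr => i _.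
by rewrite /even_weight oddM /= mulr1 exprM sqrrN expr1n mul1r natrM invfM.
Qed.

(** The constant coefficient of ['X^k] modulo ['X^4 + 1], whose roots are the primitive eighth roots
    of unity. *)
Definition quad_weight (k : nat) : rat :=
  if (4 %| k)%N then (-1) ^+ (k %/ 4) else 0.

(* [quad_shift i n] is the constant coefficient of ['X^i * ('X + 1) ^+ n]
   modulo ['X^4 + 1]. *)
Definition quad_shift (i n : nat) : rat :=
  bin_transform (fun k => quad_weight (k + i)) n.

Lemma quad_shiftS i n : quad_shift i n.+1 = quad_shift i n + quad_shift i.+1 n.
Proof.
rewrite /quad_shift bin_transformS; congr (_ + _).
by apply: eq_bigr => k _; rewrite addSnnS.
Qed.

Lemma quad_prime p : prime p -> odd p ->
  quad_shift 0 p - (1 - p%:R / 4 * \sum_(0 <= j < p %/ 4) (-1) ^+ j.+1 / j.+1%:R)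
    \in p_ideal p 2.
Proof.
move=> p_pr p_odd.
have np : (4 %| p)%N = false by apply/negP => /dvdnP[c pc]; rewrite pc oddM andbF in p_odd.
have wI k : quad_weight k \in p_integral p.
  by rewrite /quad_weight; case: ifP; rewrite ?rpred0 // rpredX // rpredN rpred1.
have := @bin_transform_prime2 p quad_weight p_pr wI.
have -> : quad_weight 0 + quad_weight p = 1.
  by rewrite {2}/quad_weight np addr0 /quad_weight div0n.
rewrite (@big_nat_dvdn (fun k => (-1) ^+ k * quad_weight k / k%:R) 4) //; last first.
  by move=> k; rewrite /quad_weight => /negPf->; rewrite mulr0 mul0r.
have -> : (p.-1 %/ 4 = p %/ 4)%N.
  by have := divnS p.-1 (d := 4) isT; rewrite prednK ?prime_gt0 // np.
rewrite (_ : bin_transform _ _ = quad_shift 0 p); last first.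
  by apply: eq_bigr => k _; rewrite addn0.
set s := \sum_(_ <= _ < _) _; set t := \sum_(_ <= _ < _) _.
suff -> : p%:R * s = p%:R / 4 * t by [].
rewrite -mulrA; congr (_ * _); rewrite /s /t mulr_sumr; apply: eq_bigr => i _.
rewrite /quad_weight dvdn_mulr // mulKn // exprM -signr_odd /= natrM.
by rewrite invfM expr1n mul1r mulrCA.
Qed.

(** * Pell numbers and eighth roots of unity *)

Definition pellR (n : nat) : rat := (pell n)%:R.

(* (1 + sqrt 2) ^ n = half_lucas n + pellR n * sqrt 2. *)
Definition half_lucas (n : nat) : rat := pellR n.+1 - pellR n.

Lemma pellRS n : pellR n.+1 = half_lucas n + pellR n.
Proof. by rewrite subrK. Qed.

Lemma half_lucasS n : half_lucas n.+1 = half_lucas n + 2 * pellR n.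
Proof.
have E : pellR n.+2 = 2 * pellR n.+1 + pellR n by rewrite /pellR -natrM -natrD.
by rewrite /half_lucas E; ring.
Qed.

Lemma half_lucas0 : half_lucas 0 = 1. Proof. by []. Qed.

Lemma pellR0 : pellR 0 = 0. Proof. by []. Qed.

Lemma pell_addE m n :
  half_lucas (m + n) = half_lucas m * half_lucas n + 2 * pellR m * pellR n
  /\ pellR (m + n) = half_lucas m * pellR n + pellR m * half_lucas n.
Proof.
elim: m => [|m [IHl IHp]]; first by rewrite half_lucas0 pellR0 add0n; split; ring.
by rewrite addSn half_lucasS pellRS half_lucasS pellRS IHl IHp; split; ring.
Qed.

(** The norm of 1 + sqrt 2 is -1. *)
Lemma half_lucas_norm n : half_lucas n ^+ 2 - 2 * pellR n ^+ 2 = (-1) ^+ n.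
Proof.
elim: n => [|n IHn]; first by rewrite half_lucas0 pellR0; ring.
by rewrite half_lucasS pellRS [(-1) ^+ _]exprS -IHn; ring.
Qed.

(** The coefficient of sqrt 2 in (sqrt 2)^k; at k + 1 it is the rational part of (sqrt 2)^k. *)
Definition pell_weight (k : nat) : rat := if odd k then 2 ^+ k./2 else 0.

Lemma pell_transform n :
  bin_transform pell_weight n = pellR n
  /\ bin_transform (fun k => pell_weight k.+1) n = half_lucas n.
Proof.
elim: n => [|n [IHp IHl]]; first by rewrite !bin_transform0.
rewrite !bin_transformS IHp IHl pellRS half_lucasS addrC; split=> //.
congr (_ + _); rewrite -IHp; apply: bin_transformZ => k.
by rewrite /pell_weight /= negbK; case: ifP; rewrite ?exprS // mulr0.
Qed.

(** Frobenius: (1 + sqrt 2)^p is 1 + (sqrt 2)^p modulo p. *)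
Lemma pell_prime p : prime p -> odd p ->
  pellR p - 2 ^+ p./2 \in p_ideal p 1 /\ half_lucas p - 1 \in p_ideal p 1.
Proof.
move=> p_pr p_odd; have [<- <-] := pell_transform p.
have wI k : pell_weight k \in p_integral p.
  by rewrite /pell_weight; case: ifP; rewrite ?rpred0 // rpredX // rpred_nat.
have := bin_transform_prime p_pr wI; rewrite {2 3}/pell_weight p_odd add0r => ->.
have := bin_transform_prime p_pr (fun k => wI k.+1).
by rewrite {2 3}/pell_weight /= p_odd addr0 expr0 => ->.
Qed.

(** Expansion of (1 + X)^4 as 4 X + 6 X^2 + 4 X^3 modulo ['X^4 + 1]. *)
Lemma quad_shift_add4 n :
  [/\ quad_shift 0 n.+4
        = 4 * quad_shift 1 n + 6 * quad_shift 2 n + 4 * quad_shift 3 n,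
      quad_shift 1 n.+4
        = 4 * quad_shift 2 n + 6 * quad_shift 3 n - 4 * quad_shift 0 n,
      quad_shift 2 n.+4
        = 4 * quad_shift 3 n - 6 * quad_shift 0 n - 4 * quad_shift 1 n
    & quad_shift 3 n.+4
        = - (4 * quad_shift 0 n + 6 * quad_shift 1 n + 4 * quad_shift 2 n)].
Proof.
have S2 i : quad_shift i n.+2
    = quad_shift i n + 2 * quad_shift i.+1 n + quad_shift i.+2 n.
  by rewrite !quad_shiftS; ring.
have S4 i : quad_shift i n.+4 = quad_shift i n + 4 * quad_shift i.+1 n
    + 6 * quad_shift i.+2 n + 4 * quad_shift i.+3 n + quad_shift i.+4 n.
  by do 2!rewrite quad_shiftS; rewrite !(quad_shiftS _ n.+2) !S2; ring.
have n4 i : quad_shift i.+4 n = - quad_shift i n.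
  rewrite -mulN1r; apply: bin_transformZ => k; rewrite mulN1r /quad_weight.
  rewrite addnS 3!addnS -[(k + i).+4]addn4 dvdn_addl //.
  by case: ifP => _; rewrite ?oppr0 // divnDr // divnn addn1 exprS mulN1r.
by rewrite !S4 !n4; split; ring.
Qed.

Lemma half_lucas_add4 n : half_lucas n.+4 = 17 * half_lucas n + 24 * pellR n.
Proof. by rewrite -add4n (pell_addE 4 n).1 /half_lucas /pellR /=; ring. Qed.

Lemma pellR_add4 n : pellR n.+4 = 12 * half_lucas n + 17 * pellR n.
Proof. by rewrite -add4n (pell_addE 4 n).2 /half_lucas /pellR /=; ring. Qed.

(** For an eighth root of unity zeta with sqrt 2 = zeta - zeta^3, the power (1 + zeta)^8 is -4 (1 +
    sqrt 2)^4; the four values are read off from the powers of zeta. *)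
Lemma quad_shift_mod8 k :
  [/\ quad_shift 0 (8 * k) = (-4) ^+ k * half_lucas (4 * k),
      quad_shift 1 (8 * k) = (-4) ^+ k * pellR (4 * k),
      quad_shift 2 (8 * k) = 0
    & quad_shift 3 (8 * k) = - ((-4) ^+ k * pellR (4 * k))].
Proof.
elim: k => [|k [t0 t1 t2 t3]].
  by rewrite /quad_shift !bin_transform0 half_lucas0.
have -> : (8 * k.+1 = (8 * k).+4.+4)%N by lia.
have -> : (4 * k.+1 = (4 * k).+4)%N by lia.
have [-> -> -> ->] := quad_shift_add4 (8 * k).+4.
have [-> -> -> ->] := quad_shift_add4 (8 * k).
rewrite t0 t1 t2 t3 half_lucas_add4 pellR_add4 exprS.
by split; ring.
Qed.

Lemma quad_shift_odd8 k (h := half_lucas (4 * k)) (q := pellR (4 * k)) :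
  [/\ quad_shift 0 (8 * k + 1) = (-4) ^+ k * (h + q),
      quad_shift 0 (8 * k + 3) = (-4) ^+ k * (h + 2 * q),
      quad_shift 0 (8 * k + 5) = - ((-4) ^+ k * (4 * h + 6 * q))
    & quad_shift 0 (8 * k + 7) = - ((-4) ^+ k * (34 * h + 48 * q))].
Proof.
have [t0 t1 t2 t3] := quad_shift_mod8 k.
have S3 i n : quad_shift i n.+3 = quad_shift i n + 3 * quad_shift i.+1 n
    + 3 * quad_shift i.+2 n + quad_shift i.+3 n by rewrite !quad_shiftS; ring.
have [s0 s1 s2 s3] := quad_shift_add4 (8 * k).
rewrite !addnS addn0 !(S3 0 _.+4) !(quad_shiftS 0 _.+4) (S3 0 (8 * k)%N) (quad_shiftS 0 (8 * k)%N) s0 s1 s2 s3 t0 t1 t2 t3 -/h -/q.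
by split; ring.
Qed.

(** Here [s] plays the role of (2/p) and [q] of p - (2/p); each odd class modulo 8 is checked with p
    = 8k + r. *)
Lemma quad_shift_sqr p (s : rat) (q : nat) : odd p ->
    s = (if (p %% 8 == 1)%N || (p %% 8 == 7)%N then 1 else -1) ->
    q = (if (p %% 8 == 1)%N || (p %% 8 == 7)%N then p.-1 else p.+1) ->
  4 * quad_shift 0 p ^+ 2
    = s * 2 ^+ p./2 * (1 + 3 * (s * half_lucas q) + 4 * pellR q).
Proof.
move=> p_odd -> ->; pose k := (p %/ 8)%N; have pE := divn_eq p 8.
have [l2 p2] := pell_addE (4 * k) (4 * k).
have := half_lucas_norm (4 * k); rewrite -signr_odd oddM /= expr0.
have [t1 t3 t5 t7] := quad_shift_odd8 k.
have e8 : (8 * k = 4 * k + 4 * k)%N by lia.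
have p16 : 2 ^+ (4 * k) = ((-4) ^+ k) ^+ 2 :> rat.
  by rewrite exprM [RHS]exprAC; congr (_ ^+ _); ring.
have pk : [|| p == 8 * k + 1, p == 8 * k + 3, p == 8 * k + 5 | p == 8 * k + 7]%N.
  by lia.
move: (half_lucas (4 * k)) (pellR (4 * k)) l2 p2 t1 t3 t5 t7 => a b l2 p2 t1 t3 t5 t7.
(* The exponent 4k is even, so the norm is 1; modulo this relation each case is a polynomial
   identity. *)
move=> ab1; have ab : a ^+ 2 = 1 + 2 * b ^+ 2 by apply/eqP; rewrite -subr_eq ab1.
case/or4P: pk => /eqP E.
- have -> : (p %% 8 = 1)%N by lia.
  have -> : p./2 = (4 * k)%N by lia.
  have -> : p.-1 = (4 * k + 4 * k)%N by lia.
  rewrite E t1 /= l2 p2 p16; ring: ab.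
- have -> : (p %% 8 = 3)%N by lia.
  have -> : p./2 = (4 * k).+1 by lia.
  have -> : p.+1 = (4 * k + 4 * k).+4 by lia.
  rewrite E t3 /= !(half_lucasS, pellRS) l2 p2 [2 ^+ _.+1]exprS p16; ring: ab.
- have -> : (p %% 8 = 5)%N by lia.
  have -> : p./2 = (4 * k).+2 by lia.
  have -> : p.+1 = (4 * k + 4 * k).+4.+2 by lia.
  rewrite E t5 /= !(half_lucasS, pellRS) l2 p2 2![2 ^+ _.+1]exprS p16; ring: ab.
- have -> : (p %% 8 = 7)%N by lia.
  have -> : p./2 = (4 * k).+3 by lia.
  have -> : p.-1 = (4 * k + 4 * k).+4.+2 by lia.
  rewrite E t7 /= !(half_lucasS, pellRS) l2 p2 3![2 ^+ _.+1]exprS p16; ring: ab.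
Qed.

(** * Euler's criterion *)

Lemma Fp_nat_eq0 p n : prime p -> (n%:R == 0 :> 'F_p) = (p %| n)%N.
Proof. by move=> p_pr; rewrite (dvdn_pcharf (pchar_Fp p_pr)). Qed.

Lemma Fp_int_eq0 p (z : int) : prime p -> (z%:~R == 0 :> 'F_p) = (p %| `|z|)%N.
Proof.
move=> p_pr; rewrite -Fp_nat_eq0 //; case: z => k //=.
by rewrite NegzE mulrNz oppr_eq0.
Qed.

(** If a nonresidue [a] had a^n = 1 with n = (p-1)/2, then X^n - 1 would have the n + 1 distinct
    roots a, 1^2, ..., n^2. *)
Lemma euler_criterion (a : int) p : prime p -> odd p ->
  (p %| `|legendre a p - a ^+ p./2|)%N.
Proof.
move=> p_pr p_odd; rewrite -Fp_int_eq0 // rmorphB rmorphXn /= subr_eq0.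
set n := p./2; have pE : p = (2 * n).+1 by rewrite -[LHS]odd_double_half p_odd -mul2n.
have n0 : (0 < n)%N by have := prime_gt1 p_pr; rewrite pE; lia.
rewrite /legendre; set al : 'F_p := a%:~R.
have al0 : (p %| a)%Z = (al == 0) by rewrite Fp_int_eq0.
have fermat (x : 'F_p) : x != 0 -> x ^+ n * x ^+ n = 1.
  move=> x0; apply: (mulfI x0); rewrite mulr1 -exprD -exprS.
  by rewrite addnn -mul2n -pE -{2}(expf_card x) card_Fp.
have sqE (x : 'I_p) : (x%:Z ^+ 2 == a %[mod p])%Z = ((x : nat)%:R ^+ 2 == al).
  rewrite eqz_mod_dvd -subr_eq0; transitivity ((x%:Z ^+ 2 - a)%:~R == 0 :> 'F_p).
    by rewrite Fp_int_eq0.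
  by rewrite rmorphB rmorphXn.
rewrite al0; have [->|al_n0] := eqVneq al 0; first by rewrite expr0n gtn_eqF.
case: ifPn => [/existsP[x]|/existsPn nsq].
  rewrite sqE => /eqP E; rewrite -E expr2 exprMn fermat //.
  by apply: contraNneq al_n0 => x0; rewrite -E x0 expr0n.
suff /negPf n1 : al ^+ n != 1.
  have : (al ^+ n - 1) * (al ^+ n + 1) == 0.
    by rewrite -subr_sqr_1 expr2 fermat // subrr.
  by rewrite mulf_eq0 subr_eq0 n1 /= addr_eq0 => /eqP ->.
apply/eqP => al1; pose sq i : 'F_p := i.+1%:R ^+ 2.
have sq_n0 i : (i < n)%N -> i.+1%:R != 0 :> 'F_p.
  by move=> i_n; rewrite Fp_nat_eq0 //; apply/negP => /dvdn_leq; lia.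
have szP := size_Xn_sub_1 'F_p n0.
have P0 : 'X^n - 1 != 0 :> {poly 'F_p} by rewrite -size_poly_eq0 szP.
have := @max_poly_roots _ _ (al :: [seq sq i | i <- iota 0 n]) P0.
rewrite szP /= size_map size_iota ltnn => contra.
suff: false by []; apply: contra.
- rewrite rootE !hornerE al1 subrr eqxx /=.
  apply/allP => _ /mapP[i + ->]; rewrite mem_iota => /andP[_ i_n].
  by rewrite rootE !hornerE /sq expr2 exprMn fermat ?subrr // sq_n0.
- apply/andP; split.
    apply/mapP => -[i]; rewrite mem_iota => /andP[_ i_n] E.
    have ip : (i.+1 < p)%N by lia.
    by have := nsq (Ordinal ip); rewrite sqE /= -/(sq i) -E eqxx.
  (* Equal squares would make p divide the sum or the difference of two numbers in 1, ..., n; the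
     sum is positive and below p, and the difference is too small unless it is 0. *)
  rewrite map_inj_in_uniq ?iota_uniq // => i j; rewrite !mem_iota /= => i_n j_n.
  move/eqP; rewrite -subr_eq0 subr_sqr mulf_eq0 -natrD orbC Fp_nat_eq0 //.
  case/orP => [/dvdn_leq|]; first by lia.
  have -> : i.+1%:R - j.+1%:R = (i%:Z - j%:Z)%:~R :> 'F_p.
    by rewrite rmorphB /= -!natr1; ring.
  rewrite Fp_int_eq0 // => /dvdnP[[|c] ijc]; first by lia.
  have : (p <= `|(i%:Z - j%:Z)%R|)%N by rewrite ijc mulSn leq_addr.
  by lia.
Qed.

(* Everything rests on the exact identity
   [4 tau ^ 2 = u (1 + 3 s half_lucas q + 4 P_q)] for the sign [s] read off from
   p mod 8. Modulo p it forces [u = 1], so the supplementary law [s = (2/p)] is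
   a by-product. *)
Section PellCongruence.

Variables (p n : nat) (s : int).
Hypotheses (p_pr : prime p) (p_gt3 : (3 < p)%N) (pE : p = (2 * n).+1).
Hypothesis sE : s = (if (p %% 8 == 1)%N || (p %% 8 == 7)%N then 1 else -1).

Let q : nat := `|p%:Z - s|%N.
Let sQ : rat := s%:~R.
Let u : rat := sQ * 2 ^+ n.
Let tau : rat := quad_shift 0 p.
Let w : rat := p%:R / 4 * harmonic n.

Let p0 : (0 < p)%N. Proof. exact: prime_gt0. Qed.

Let p_odd : odd p. Proof. by rewrite pE /= mul2n odd_double. Qed.

Let halfp : p./2 = n. Proof. by lia. Qed.

Let s_sqr : sQ * sQ = 1. Proof. by rewrite /sQ sE; case: ifP. Qed.

Let q_even : odd q = false.
Proof. by rewrite /q sE; case: ifP => _; rewrite pE; lia. Qed.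

Let half2 : (2%:R : rat)^-1 \in p_integral p.
Proof. by apply: p_integral_ltV => //; lia. Qed.

Let sI : sQ \in p_integral p. Proof. exact: rpred_int. Qed.

Let pellI k : pellR k \in p_integral p. Proof. exact: rpred_nat. Qed.

Let ideal1W e x : (0 < e)%N -> x \in p_ideal p e -> x \in p_ideal p 1.
Proof. by move=> e0; apply: p_idealW. Qed.

Let idealM11 x y : x \in p_ideal p 1 -> y \in p_ideal p 1 -> x * y \in p_ideal p 2.
Proof. exact: p_idealM. Qed.

Let ideal_half e x : 2%:R * x \in p_ideal p e -> x \in p_ideal p e.
Proof. by move/(p_idealMl half2); rewrite mulKf. Qed.

(** Multiply (1 + sqrt 2)^p by (1 + sqrt 2)^(-s), where the inverse of 1 + sqrt 2 is sqrt 2 - 1. *)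
Let pellq : pellR q = half_lucas p - sQ * pellR p.
Proof.
rewrite /q /sQ sE; case: ifP => _.
  have -> : `|p%:Z - 1|%N = (2 * n)%N by lia.
  by rewrite pE half_lucasS pellRS; ring.
have -> : `|(p%:Z - -1)%R|%N = p.+1 by lia.
by rewrite pellRS; ring.
Qed.

Let lucasq : sQ * half_lucas q = 2 * (sQ * pellR p) - half_lucas p.
Proof.
rewrite /q /sQ sE; case: ifP => _.
  have -> : `|p%:Z - 1|%N = (2 * n)%N by lia.
  by rewrite pE half_lucasS pellRS; ring.
have -> : `|(p%:Z - -1)%R|%N = p.+1 by lia.
by rewrite half_lucasS; ring.
Qed.

Let tau_sqr : 4 * tau ^+ 2 = u * (1 + 3 * (sQ * half_lucas q) + 4 * pellR q).
Proof.
rewrite /u -halfp; apply: quad_shift_sqr => //; first by rewrite /sQ sE; case: ifP.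
by rewrite /q sE; case: ifP => _; rewrite pE; lia.
Qed.

Let harmonicI : harmonic n \in p_integral p.
Proof.
rewrite /harmonic big_nat_cond; apply: rpred_sum => i /andP[/andP[_ i_n] _].
by apply: p_integral_ltV => //; lia.
Qed.

Let pI : p%:R \in p_ideal p 1. Proof. by rewrite p_ideal_nat. Qed.

Let quarter : (4%:R : rat)^-1 \in p_integral p.
Proof. by rewrite (_ : 4%:R^-1 = 2%:R^-1 * 2%:R^-1 :> rat) // rpredM. Qed.

Let wI : w \in p_ideal p 1.
Proof. by rewrite /w !p_idealMr. Qed.

Let uI : u \in p_integral p.
Proof. by rewrite rpredM // rpredX // rpred_nat. Qed.

Let u_sqr : u ^+ 2 - (1 - 2 * w) \in p_ideal p 2.
Proof.
have -> : u ^+ 2 = 2 ^+ (2 * n).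
  by rewrite /u expr2 mulrACA s_sqr mul1r -exprD addnn mul2n.
have -> : 2 * w = p%:R / 2 * harmonic n by rewrite /w; field.
exact: pow2_prime.
Qed.

Let u_sqr1 : u ^+ 2 - 1 \in p_ideal p 1.
Proof.
have -> : u ^+ 2 - 1 = (u ^+ 2 - (1 - 2 * w)) - 2%:R * w by ring.
by rewrite rpredB ?(ideal1W _ u_sqr) // p_idealMl ?rpred_nat.
Qed.

Let alt_harmonic : rat := \sum_(0 <= j < p %/ 4) (-1) ^+ j.+1 / j.+1%:R.

Let tau_quad : tau - (1 - p%:R / 4 * alt_harmonic) \in p_ideal p 2.
Proof. exact: quad_prime. Qed.

Let tau1 : tau - 1 \in p_ideal p 1.
Proof.
have -> : tau - 1 = (tau - (1 - p%:R / 4 * alt_harmonic)) - p%:R / 4 * alt_harmonic.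
  by ring.
rewrite rpredB ?(ideal1W _ tau_quad) // !p_idealMr //.
rewrite /alt_harmonic big_nat_cond; apply: rpred_sum => i /andP[/andP[_ i_n] _].
apply: rpredM; first by apply: rpredX; rewrite rpredN rpred1.
by apply: p_integral_ltV => //; apply: leq_ltn_trans i_n (ltn_Pdiv _ p0).
Qed.

Let lucas_p : half_lucas p - 1 \in p_ideal p 1.
Proof. by have [] := pell_prime p_pr p_odd. Qed.

Let pell_p : sQ * pellR p - u \in p_ideal p 1.
Proof.
have [+ _] := pell_prime p_pr p_odd; rewrite halfp => /(p_idealMl sI).
by rewrite mulrBr.
Qed.

(** Modulo p, [tau_sqr] reads 4 = u (1 + 3 (2u - 1) + 4 (1 - u)) = 2u + 2u^2, and u^2 = 1. *)
Let u1 : u - 1 \in p_ideal p 1.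
Proof.
have E := tau_sqr; rewrite lucasq pellq in E.
apply: ideal_half; move: E tau1 pell_p lucas_p u_sqr1 uI.
move: u tau (sQ * pellR p) (half_lucas p) => v t a l E t1 av l1 v1 vI.
have -> : 2%:R * (v - 1) = 4%:R * ((t - 1) * (t - 1) + 2%:R * (t - 1))
   - v * (2%:R * (a - v) + (l - 1)) - 2%:R * (v ^+ 2 - 1).
  transitivity (4 * t ^+ 2 - 4 - v * (2 * (a - v) + (l - 1)) - 2 * (v ^+ 2 - 1)).
    by rewrite E; ring.
  by ring.
have natI k x : x \in p_ideal p 1 -> k%:R * x \in p_ideal p 1.
  by apply: p_idealMl; apply: rpred_nat.
have tI : (t - 1) * (t - 1) \in p_ideal p 1 by exact: ideal1W (idealM11 t1 t1).
have nat2I x : x \in p_ideal p 1 -> 2%:R * x \in p_ideal p 1 by exact: natI.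
rewrite !rpredB //; last exact: nat2I.
  by rewrite natI // rpredD // nat2I.
by rewrite p_idealMl // rpredD // nat2I.
Qed.

Let pellqI : pellR q \in p_ideal p 1.
Proof.
rewrite pellq.
have -> : half_lucas p - sQ * pellR p
  = (half_lucas p - 1) - (sQ * pellR p - u) - (u - 1) by ring.
by rewrite rpredB // rpredB.
Qed.

(** The congruence modulo p is lifted by the norm: with x the difference, (1 + x)^2 = 1 + 2 P_q^2,
    where both x^2 and P_q^2 vanish modulo p^2. *)
Let lucasqI : sQ * half_lucas q - 1 \in p_ideal p 2.
Proof.
have h1 : sQ * half_lucas q - 1 \in p_ideal p 1.
  rewrite lucasq (_ : _ - 1 = 2%:R * (sQ * pellR p - u) + 2%:R * (u - 1)
                         - (half_lucas p - 1)); last by ring.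
  by rewrite rpredB // rpredD // p_idealMl // rpred_nat.
have := half_lucas_norm q; rewrite -signr_odd q_even expr0 => norm.
apply: ideal_half; move: h1; set x := sQ * half_lucas q - 1 => h1.
have -> : 2%:R * x = 2%:R * (pellR q * pellR q) - x * x.
  have : (x + 1) * (x + 1) = half_lucas q ^+ 2.
    by rewrite /x subrK mulrACA s_sqr mul1r.
  move/(canRL (subrK _)): norm => -> E.
  by apply/eqP; rewrite -subr_eq0 -[0](subrr ((x + 1) * (x + 1))) {2}E; apply/eqP; ring.
have PP := p_idealMl (rpred_nat _ 2) (idealM11 pellqI pellqI).
by rewrite rpredB // idealM11.
Qed.

Let tau_sqr2 : tau ^+ 2 - u * (1 + pellR q) \in p_ideal p 2.
Proof.
apply: ideal_half; apply: ideal_half.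
have -> : 2%:R * (2%:R * (tau ^+ 2 - u * (1 + pellR q)))
   = 3%:R * u * (sQ * half_lucas q - 1).
  transitivity (4 * tau ^+ 2 - 4 * (u * (1 + pellR q))); first by ring.
  by rewrite tau_sqr; ring.
by rewrite p_idealMl // rpredM ?rpred_nat.
Qed.

(** The square root near 1 of u^2 = 1 - 2w, with (u - 1)^2 negligible. *)
Let u2 : u - 1 + w \in p_ideal p 2.
Proof.
apply: ideal_half.
have -> : 2%:R * (u - 1 + w) = (u ^+ 2 - (1 - 2 * w)) - (u - 1) * (u - 1) by ring.
by rewrite rpredB ?idealM11.
Qed.

(** Euler's criterion gives (2/p) = 2^n modulo p, and [u1] turns 2^n into [s]; two signs congruent
    modulo p > 2 agree. *)
Lemma legendre2_mod8 : legendre 2 p = s.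
Proof.
have : (legendre 2 p - s)%:~R \in p_ideal p 1.
  have := euler_criterion 2 p_pr p_odd; rewrite -p_ideal_int // halfp.
  rewrite !rmorphB rmorphXn /= => E.
  have -> : (legendre 2 p)%:~R - s%:~R
     = ((legendre 2 p)%:~R - 2%:~R ^+ n) + sQ * (u - 1) :> rat.
    by rewrite /u mulrBr mulrA s_sqr mul1r mulr1 addrA subrK.
  by rewrite rpredD // p_idealMl.
rewrite p_ideal_int // => /dvdnP[c E].
have le2 : (`|legendre 2 p - s| <= 2)%N.
  by rewrite /legendre sE; do 3?[case: ifP => _].
case: c E => [/eqP|c E]; first by rewrite mul0n absz_eq0 subr_eq0 => /eqP.
suff : (p <= 2)%N by rewrite leqNgt ltnW.
by apply: leq_trans le2; rewrite E leq_pmull.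
Qed.

(** Modulo p^2, tau^2 = 2 tau - 1 = 1 - (p/2) [alt_harmonic], while u (1 + P_q) = 1 + P_q - w;
    [tau_sqr2] equates the two. *)
Lemma quarter_sum_pell :
  1 + w - p%:R / 2 * alt_harmonic - (1 + pellR q) \in p_ideal p 2.
Proof.
have -> : 1 + w - p%:R / 2 * alt_harmonic - (1 + pellR q)
  = - (2%:R * (tau - (1 - p%:R / 4 * alt_harmonic))) - (tau - 1) * (tau - 1)
    + (tau ^+ 2 - u * (1 + pellR q))
    + ((u - 1 + w) * (1 + pellR q) - w * pellR q) by field.
have tau_quad2 := p_idealMl (rpred_nat _ 2) tau_quad.
have tau11 := idealM11 tau1 tau1.
have head : - (2%:R * (tau - (1 - p%:R / 4 * alt_harmonic)))
    - (tau - 1) * (tau - 1) \in p_ideal p 2 by rewrite rpredB // rpredN.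
have uw : (u - 1 + w) * (1 + pellR q) \in p_ideal p 2.
  by rewrite p_idealMr // rpredD ?rpred1.
have wq := idealM11 wI pellqI.
by rewrite rpredD //; [rewrite rpredD | rewrite rpredB].
Qed.

End PellCongruence.

(* The index p - (2/p) is p - 1 or p + 1, hence positive, so taking its
   absolute value only converts it to nat. *)
Theorem theorem3p2 (p : nat) (p_prime : prime p) (p_gt3 : (3 < p)%N) :
  p_integral_congr p (p ^ 2)
    (\sum_(0 <= k < ((p - 1) %/ 2).+1)
       ('C(2 * k, k) * 'C(4 * k, 2 * k))%:R / 64%:R ^+ k)
    ((-1) ^+ (p %/ 4) * (1 + (pell `|p%:Z - legendre 2 p|%N)%:R)).
Proof.
have p_odd : odd p by have := even_prime p_prime; lia.
pose n := p./2; have pE : p = (2 * n).+1 by rewrite /n; lia.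
have signI k : (-1) ^+ k \in p_integral p by rewrite rpredX ?rpredN ?rpred1.
apply: p_ideal_congr; first exact: prime_gt0.
- apply: rpred_sum => k _; rewrite rpredM ?rpred_nat // -natrX p_integral_natV //.
  by rewrite coprimeXr // (@coprimeXr 6 p 2) // prime_coprime // dvdn_prime2 //; lia.
- by rewrite rpredM // rpredD ?rpred1 ?rpred_nat.
rewrite (legendre2_mod8 p_prime p_gt3 pE (erefl _)).
have -> : ((p - 1) %/ 2 = n)%N by lia.
pose y : rat := - (p%:R / 4).
under eq_bigr do rewrite central_bin_term.
have -> : \sum_(0 <= k < n.+1) bin_pair (- (1 / 4)) k = bin_pair_sum (y + (p %/ 4)%:R) n.
  apply: eq_bigr => k _; have p4 := divn_eq p 4.
  (* The point y + [p/4] is -1/4 or -3/4 according to p modulo 4; the second is the mirror image of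
     the first under [bin_pairC]. *)
  have [p1|p3] : (p %% 4 = 1 \/ p %% 4 = 3)%N by lia.
    by congr bin_pair; rewrite /y {1}p4 p1 natrD natrM; field.
  rewrite -bin_pairC; congr bin_pair.
  by rewrite /y {1}p4 p3 natrD natrM; field.
have := quarter_sum_pell p_prime p_gt3 pE (erefl _).
move/(p_idealMl (signI (p %/ 4)%N)).
have := bin_pair_sum_quarter p_prime p_gt3 pE (erefl y) (m := p %/ 4) ltac:(lia).
set S := (-1) ^+ _; set A := bin_pair_sum _ _.
set B := \sum_(_ <= _ < _) _; set h := harmonic n; set C := pellR _ => sumE pellE.
(* With y = -p/4, the terms -y h + 2 y B become (p/4) h - (p/2) B. *)
rewrite (_ : _ - _ = (A - S * (1 - y * h + 2 * y * B))
                     + S * (1 + p%:R / 4 * h - p%:R / 2 * B - (1 + C))).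
  exact: rpredD.
by rewrite -[(pell _)%:R]/C /y; field.
Qed.
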